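(* Let $H:(\mathbb{P}\times\mathbb{R}^m)^{+}\to\mathbb{R}^{n_y}$ be a response map which has an impulse response representation (IRR) and such that the associated family $\Psi_H$ has a finite Hankel-rank. Then the following are equivalent: (1) $H$ has the $\ell_\infty$-forgetting property; (2) $H$ is exponentially $\ell_\infty$-forgetting (with some rate in $(0,1)$); (3) $H$ is IRR-UED (with some rate in $(0,1)$); (4) $H$ has a realization by a globally uniformly exponentially stable (GUES) LPV-SSA (LSS, in the case $\mathbb{P}=\{e_1,\ldots,e_{n_p}\}$). Moreover, if $H$ is $\ell_\infty$-forgetting, then there is a rate $\beta\in(0,1)$ such that $H$ is exponentially $\ell_\infty$-forgetting with rate $\beta$ and all minimal LPV-SSA (LSS, in the case $\mathbb{P}=\{e_1,\ldots,e_{n_p}\}$) realizations of $H$ are GUES with the rate $\beta$.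
   Context: Notation: $X^{*}$, $X^{+}$, $X^{k}$, $X^{\infty}$ denote the finite words (including the empty word), nonempty finite words, words of length $k$, and infinite sequences over $X$; $w[k]$ is the $k$-th element and $|w|$ the length of $w$; $\|\cdot\|_2$ is the Euclidean/spectral norm; for a sequence $\underline{v}$ of vectors, $\|\underline{v}\|_\infty=\sup_i\max_j|(\underline{v}[i])_j|$. $\mathbb{P}\subseteq\mathbb{R}^{n_p}$ is contained in the standard simplex $\{x\in[0,1]^{n_p}\mid\sum_i x_i=1\}$ and contains the standard unit vectors $e_1,\ldots,e_{n_p}$. $Q=\{1,\ldots,n_p\}$. LPV-SSA: a system $x(t+1)=A(p(t))x(t)+B(p(t))v(t)$, $x(0)=0$, $y(t)=C(p(t))x(t)$, with scheduling $p(t)\in\mathbb{P}$, control input $v(t)\in\mathbb{R}^m$, output $y(t)\in\mathbb{R}^{n_y}$, $x(t)\in\mathbb{R}^n$, and $A(p)=\sum_{i=1}^{n_p}A_ip_i$, $B(p)=\sum_{i=1}^{n_p}B_ip_i$, $C(p)=\sum_{i=1}^{n_p}C_ip_i$ for real matrices $A_i,B_i,C_i$. Its dimension is $n$. When $\mathbb{P}=\{e_1,\ldots,e_{n_p}\}$ it is called a linear switched system (LSS). It is a realization of $H$ if for all $t\ge1$ and $w=(p[1],v[1])\cdots(p[t],v[t])$ one has $H(w)=C(p[t])x_t$, where $x_1=0$ and $x_{s+1}=A(p[s])x_s+B(p[s])v[s]$. It is minimal if its dimension is minimal among all LPV-SSA realizations of $H$. It is GUES with rate $\beta\in(0,1)$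 if there is $C\ge1$ such that $\|A(\underline{p}[k])\cdots A(\underline{p}[1])\|_2<C\beta^k$ for all $k>0$, $\underline{p}\in\mathbb{P}^k$; it is GUES if this holds for some $\beta\in(0,1)$. IRR: $H$ has an impulse response representation if there is $S:\bigcup_{k=2}^{\infty}Q^k\to\mathbb{R}^{n_y\times m}$ such that for all $\underline{p}\in\mathbb{P}^\infty$, $\underline{v}\in(\mathbb{R}^m)^\infty$, $t\ge1$, $$H((\underline{p}[1],\underline{v}[1])\cdots(\underline{p}[t],\underline{v}[t]))=\sum_{\tau=1}^{t-1}(h\diamond\underline{p})(t,\tau)\,\underline{v}[\tau],\qquad (h\diamond\underline{p})(t,\tau)=\sum_{s\in Q^{t-\tau+1}}S(s)\,\underline{p}_s(t)\quad(1\le\tau\le t-1),$$ where $\underline{p}_s(t)=\prod_{i=1}^{|s|}(\underline{p}[t-|s|+i])_{s[i]}$ and $(\underline{p}[k])_r$ is the $r$-th component of $\underline{p}[k]$. $\Psi_H$: for $q\in Q$, $l\in\{1,\ldots,m\}$, let $M_{q,l}:Q^{*}\to\mathbb{R}^{n_pn_y}$, $M_{q,l}(w)=\big[(S_{\cdot,l}(qw1))^T,\ldots,(S_{\cdot,l}(qwn_p))^T\big]^T$, where $S_{\cdot,l}(s)$ is the $l$-th column of $S(s)$. Then $\Psi_H=\{M_{q,l}\}_{(q,l)\in Q\times\{1,\ldots,m\}}$. Its Hankel-rank is the dimension of the span (pointwise operations) of the maps $w\mapsto M_{q,l}(vw)$ on $Q^{*}$, over all $v\in Q^{*}$, $q\in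 Q$, $1\le l\le m$. IRR-UED with rate $\beta\in(0,1)$: there is $C>0$ such that for all $N\ge1$, $\sup_{\underline{p}\in\mathbb{P}^\infty,\,\tau\ge1}\|(h\diamond\underline{p})(N+\tau,\tau)\|_2<C\beta^{N-1}$. $\ell_\infty$-forgetting: $H$ has the $\ell_\infty$-forgetting property if there is a decreasing sequence $\{G_{H,k}\}_{k=0}^\infty$ of real numbers with $\lim_{k\to\infty}G_{H,k}=0$ such that for every $t\ge1$, every $\underline{p}\in\mathbb{P}^t$, every $0\le k\le t$, and every $\underline{v}_1,\underline{v}_2\in(\mathbb{R}^m)^t$ with $\underline{v}_1[s]=\underline{v}_2[s]$ for $s=t-k+1,\ldots,t$, setting $w_i=(\underline{p}[1],\underline{v}_i[1])\cdots(\underline{p}[t],\underline{v}_i[t])$, one has $$\|H(w_1)\|_2\le G_{H,0}\|\underline{v}_1\|_\infty,\qquad \|H(w_1)-H(w_2)\|_2\le G_{H,k}\|\underline{v}_1-\underline{v}_2\|_\infty.$$ $H$ is exponentially $\ell_\infty$-forgetting with rate $\beta\in(0,1)$ if such a sequence exists which in addition satisfies $G_{H,k}<K\beta^k$ for some $K>0$ and all $k\in\mathbb{N}$ (including $k=0$). *)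

(* Defs.v *)
From HB Require Import structures.
From mathcomp Require Import all_boot all_order all_algebra.
From mathcomp Require Import all_classical all_reals all_analysis.

Set Implicit Arguments.
Unset Strict Implicit.
Unset Printing Implicit Defensive.

Import Order.TTheory GRing.Theory Num.Theory.
Import numFieldNormedType.Exports.

Local Open Scope classical_set_scope.
Local Open Scope ring_scope.

(* Sequences of scheduling values and of inputs are functions on nat indexed
   from 1, as in p[1], p[2], ...; the value at 0 is never used.  A finite
   sequence of length t is such a function of which only the values at
   1, ..., t are used. *)

Definition l2norm (R : realType) (n : nat) (x : 'cV[R]_n) : R :=
  Num.sqrt (\sum_(i < n) x i 0 ^+ 2).

(* The set below is nonempty and bounded, so that sup is a genuine supremum. *)
Definition spectral_norm (R : realType) (a b : nat) (M : 'M[R]_(a, b)) : R :=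
  sup [set l2norm (M *m x) | x in [set x : 'cV[R]_b | l2norm x <= 1]].

Definition linf_norm (R : realType) (m : nat) (v : nat -> 'cV[R]_m) (t : nat) : R :=
  \big[Num.max/0]_(1 <= s < t.+1) \big[Num.max/0]_(j < m) `|v s j 0|.

Definition simplex (R : realType) (np : nat) : set 'cV[R]_np :=
  [set x | (forall i, 0 <= x i 0 <= 1) /\ \sum_(i < np) x i 0 = 1].

Definition in_sched (R : realType) (np : nat) (P : set 'cV[R]_np) (t : nat)
    (p : nat -> 'cV[R]_np) : Prop :=
  forall s, (1 <= s <= t)%N -> P (p s).

Definition in_sched_inf (R : realType) (np : nat) (P : set 'cV[R]_np)
    (p : nat -> 'cV[R]_np) : Prop :=
  forall s, (1 <= s)%N -> P (p s).

Definition word (R : realType) (np m : nat) (p : nat -> 'cV[R]_np)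
    (v : nat -> 'cV[R]_m) (t : nat) : seq ('cV[R]_np * 'cV[R]_m) :=
  [seq (p s, v s) | s <- iota 1 t].

(* A response map (P x R^m)^+ -> R^ny is represented by a function on all words
   over R^np x R^m, of which only the values at nonempty words with scheduling
   values in P are ever used. *)
Definition response (R : realType) (np m ny : nat) : Type :=
  seq ('cV[R]_np * 'cV[R]_m) -> 'cV[R]_ny.

Section LPV.
Variables (R : realType) (np m ny : nat).

Record lpv_ssa (n : nat) := LpvSsa {
  lpvA : 'I_np -> 'M[R]_n;
  lpvB : 'I_np -> 'M[R]_(n, m);
  lpvC : 'I_np -> 'M[R]_(ny, n) }.

Definition lin_comb (a b : nat) (M : 'I_np -> 'M[R]_(a, b)) (p : 'cV[R]_np) :
    'M[R]_(a, b) :=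
  \sum_(i < np) p i 0 *: M i.

(* x_{t+1}, starting from x_1 = 0. *)
Fixpoint lpv_state n (sys : lpv_ssa n) (p : nat -> 'cV[R]_np)
    (v : nat -> 'cV[R]_m) (t : nat) : 'cV[R]_n :=
  if t is t'.+1 then
    lin_comb (lpvA sys) (p t) *m lpv_state sys p v t'
    + lin_comb (lpvB sys) (p t) *m v t
  else 0.

(* When P is the set of the standard unit vectors, an lpv_ssa is a linear
   switched system. *)
Definition realizes (P : set 'cV[R]_np) (H : response R np m ny)
    n (sys : lpv_ssa n) : Prop :=
  forall (t : nat) (p : nat -> 'cV[R]_np) (v : nat -> 'cV[R]_m),
    (1 <= t)%N -> in_sched P t p ->
    H (word p v t) = lin_comb (lpvC sys) (p t) *m lpv_state sys p v t.-1.

(* The dimension n may be 0: the zero response map has minimal dimension 0. *)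
Definition minimal_realization (P : set 'cV[R]_np) (H : response R np m ny)
    n (sys : lpv_ssa n) : Prop :=
  realizes P H sys /\
  forall n' (sys' : lpv_ssa n'), realizes P H sys' -> (n <= n')%N.

(* A(p[k]) ... A(p[1]) *)
Fixpoint transition n (sys : lpv_ssa n) (p : nat -> 'cV[R]_np) (k : nat) :
    'M[R]_n :=
  if k is k'.+1 then lin_comb (lpvA sys) (p k) *m transition sys p k' else 1%:M.

Definition gues_rate (P : set 'cV[R]_np) n (sys : lpv_ssa n) (beta : R) : Prop :=
  exists2 C : R, 1 <= C &
    forall (k : nat) (p : nat -> 'cV[R]_np), (0 < k)%N -> in_sched P k p ->
      spectral_norm (transition sys p k) < C * beta ^+ k.

Definition gues (P : set 'cV[R]_np) n (sys : lpv_ssa n) : Prop :=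
  exists2 beta : R, 0 < beta < 1 & gues_rate P sys beta.

(* p_s(t), for a word s of length k <= t. *)
Definition sched_prod (p : nat -> 'cV[R]_np) k (s : k.-tuple 'I_np) (t : nat) : R :=
  \prod_(i < k) p (t - k + i.+1)%N (tnth s i) 0.

(* (h <> p)(t, tau).  Here and below, a map S on the words of length at least 2
   is represented by a function on all words; its values at shorter words are
   never used. *)
Definition irr_kernel (S : seq 'I_np -> 'M[R]_(ny, m)) (p : nat -> 'cV[R]_np)
    (t tau : nat) : 'M[R]_(ny, m) :=
  \sum_(s : (t - tau).+1.-tuple 'I_np) sched_prod p s t *: S s.

(* S is an impulse response representation of H; as P contains the unit
   vectors, H determines S on the words of length at least 2. *)
Definition is_irr (P : set 'cV[R]_np) (H : response R np m ny)
    (S : seq 'I_np -> 'M[R]_(ny, m)) : Prop :=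
  forall (p : nat -> 'cV[R]_np) (v : nat -> 'cV[R]_m) (t : nat),
    in_sched_inf P p -> (1 <= t)%N ->
    H (word p v t) = \sum_(1 <= tau < t) irr_kernel S p t tau *m v tau.

Definition irr_ued (P : set 'cV[R]_np) (S : seq 'I_np -> 'M[R]_(ny, m))
    (beta : R) : Prop :=
  exists2 C : R, 0 < C &
    forall N : nat, (1 <= N)%N ->
      (ereal_sup [set e | exists p tau,
          [/\ in_sched_inf P p, (1 <= tau)%N &
              e = (spectral_norm (irr_kernel S p (N + tau) tau))%:E]]
        < (C * beta ^+ N.-1)%:E)%E.

Definition psi (S : seq 'I_np -> 'M[R]_(ny, m)) (q : 'I_np) (l : 'I_m)
    (w : seq 'I_np) : 'cV[R]_(\sum_(j < np) ny) :=
  \mxcol_(j < np) col l (S (q :: rcons w j)).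

Definition lin_span (V : lmodType R) (F : set V) : set V :=
  [set x | exists k (c : 'I_k -> R) (f : 'I_k -> V),
     (forall i, F (f i)) /\ x = \sum_(i < k) c i *: f i].

Definition has_dim (V : lmodType R) (W : set V) (r : nat) : Prop :=
  exists b : 'I_r -> V,
    (forall c : 'I_r -> R, \sum_(i < r) c i *: b i = 0 -> forall i, c i = 0) /\
    W = lin_span (range b).

Definition hankel_rank_is (S : seq 'I_np -> 'M[R]_(ny, m)) (r : nat) : Prop :=
  has_dim (lin_span [set f : seq 'I_np -> 'cV[R]_(\sum_(j < np) ny) |
    exists v q l, f = (fun w => psi S q l (v ++ w))]) r.

Definition finite_hankel_rank (S : seq 'I_np -> 'M[R]_(ny, m)) : Prop :=
  exists r : nat, hankel_rank_is S r.

Definition forgetting_bound (P : set 'cV[R]_np) (H : response R np m ny)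
    (G : nat -> R) : Prop :=
  [/\ decreasing_seq G, G @ \oo --> (0 : R) &
      forall (t : nat) (p : nat -> 'cV[R]_np) (k : nat)
             (v1 v2 : nat -> 'cV[R]_m),
        (1 <= t)%N -> in_sched P t p -> (k <= t)%N ->
        (forall s, (t - k + 1 <= s <= t)%N -> v1 s = v2 s) ->
        l2norm (H (word p v1 t)) <= G 0%N * linf_norm v1 t /\
        l2norm (H (word p v1 t) - H (word p v2 t))
          <= G k * linf_norm (fun s => v1 s - v2 s) t].

Definition linf_forgetting (P : set 'cV[R]_np) (H : response R np m ny) : Prop :=
  exists G : nat -> R, forgetting_bound P H G.

Definition exp_linf_forgetting (P : set 'cV[R]_np) (H : response R np m ny)
    (beta : R) : Prop :=
  exists2 G : nat -> R, forgetting_bound P H G &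
    exists2 K : R, 0 < K & forall k : nat, G k < K * beta ^+ k.

End LPV.

(* Main.v *)
Require Import Defs.
From HB Require Import structures.
From mathcomp Require Import all_boot all_order all_algebra.
From mathcomp Require Import all_classical all_reals all_analysis.
From mathcomp Require Import ring lra.

Set Implicit Arguments.
Unset Strict Implicit.
Unset Printing Implicit Defensive.

Import Order.TTheory GRing.Theory Num.Theory.
Import numFieldNormedType.Exports.

Local Open Scope classical_set_scope.
Local Open Scope ring_scope.

(** The impulse response of a realization is the product
[C(p_t) A(p_(t-1)) ... A(p_(tau+1)) B(p_tau)], so exponential decay of its
transition matrices gives exponential decay of the kernel, and summing a
geometric series gives exponential forgetting.  The content of the theorem is
the way back, from mere forgetting to exponential stability.

Comparing an input with an impulse at time [tau] with the zero input shows that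
the kernel [(h <> p)(N + tau, tau)] is bounded by a constant multiple of [G N]
([forgetting_kernel_bound]).  Let a realization be reachable and observable.
Finitely many columns of matrices [A_v B_q] span the state space, and so do, on
the dual side, finitely many rows of matrices [C_j A_w].  Hence a transition
matrix [T] is recovered, by two fixed linear maps, from finitely many entries of
the matrices [C_j A_w T A_v B_q].  These are kernel values for the schedule
obtained by extending that of [T] with unit vectors at both ends, so kernel
decay passes to the transition matrices ([kernel_bound_trans]).  Under
forgetting, all transition matrices of some fixed length are therefore
contractions of ratio 1/2, and submultiplicativity produces a geometric rate
([trans_bound_geometric]).

Such a realization exists because the span of the Hankel functions, of dimension
[r], is stable under shifts: the shifts act on it as the matrices [A_q]
([canonical_realization]).  Conversely, the Hankel functions of a realization of
dimension [n <= r] are the images of its reachable states under the observation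
map; as they span a space of dimension [r], every state is reachable and the
observation map is injective ([small_realization_reachable_observable]).  This
covers all minimal realizations, since they have dimension at most [r].

All estimates are up to constant factors, so they are made with the sum of the
absolute values of the entries, which is equivalent to the spectral norm and
submultiplicative. *)

(** * The entrywise norm *)

Section EntryNorm.
Variable R : realType.

Definition norm1 a b (M : 'M[R]_(a, b)) : R := \sum_i \sum_j `|M i j|.

Lemma norm1_ge0 a b (M : 'M[R]_(a, b)) : 0 <= norm1 M.
Proof. by apply: sumr_ge0 => i _; apply: sumr_ge0. Qed.

Lemma norm1_entry a b (M : 'M[R]_(a, b)) i j : `|M i j| <= norm1 M.
Proof.
rewrite /norm1 (bigD1 i) //= (bigD1 j) //= -addrA lerDl addr_ge0 //.
  exact: sumr_ge0.
by apply: sumr_ge0 => k _; apply: sumr_ge0.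
Qed.

Lemma norm1_le a b (M : 'M[R]_(a, b)) c :
  (forall i j, `|M i j| <= c) -> norm1 M <= a%:R * b%:R * c.
Proof.
move=> Mc; apply: (@le_trans _ _ (\sum_(i < a) \sum_(j < b) c)).
  by apply: ler_sum => i _; apply: ler_sum.
by rewrite !sumr_const !card_ord -mulrA !mulr_natl.
Qed.

Lemma norm1_0 a b : norm1 (0 : 'M[R]_(a, b)) = 0.
Proof. by rewrite /norm1 big1 // => i _; rewrite big1 // => j _; rewrite mxE normr0. Qed.

Lemma norm1D a b (M N : 'M[R]_(a, b)) : norm1 (M + N) <= norm1 M + norm1 N.
Proof.
rewrite -big_split /=; apply: ler_sum => i _; rewrite -big_split /=.
by apply: ler_sum => j _; rewrite mxE ler_normD.
Qed.

Lemma norm1_sum a b I (r : seq I) (F : I -> 'M[R]_(a, b)) :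
  norm1 (\sum_(i <- r) F i) <= \sum_(i <- r) norm1 (F i).
Proof.
elim: r => [|i r IH].
  by rewrite !big_nil norm1_0.
by rewrite !big_cons (le_trans (norm1D _ _)) // lerD2l.
Qed.

Lemma norm1Z a b x (M : 'M[R]_(a, b)) : norm1 (x *: M) = `|x| * norm1 M.
Proof.
rewrite /norm1 mulr_sumr; apply: eq_bigr => i _; rewrite mulr_sumr.
by apply: eq_bigr => j _; rewrite mxE normrM.
Qed.

Lemma norm1M a b c (M : 'M[R]_(a, b)) (N : 'M[R]_(b, c)) :
  norm1 (M *m N) <= norm1 M * norm1 N.
Proof.
rewrite {1 2}/norm1 mulr_suml; apply: ler_sum => i _.
apply: (@le_trans _ _ (\sum_k \sum_j `|M i j| * `|N j k|)).
  apply: ler_sum => k _; rewrite mxE (le_trans (ler_norm_sum _ _ _)) //.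
  by apply: ler_sum => j _; rewrite normrM.
rewrite exchange_big /= mulr_suml; apply: ler_sum => j _.
rewrite -mulr_sumr ler_wpM2l // /norm1 [leRHS](bigD1 j) //= lerDl.
by apply: sumr_ge0 => k _; apply: sumr_ge0.
Qed.

Lemma l2norm_ge_entry n (x : 'cV[R]_n) i : `|x i 0| <= l2norm x.
Proof.
rewrite -sqrtr_sqr /l2norm ler_wsqrtr // (bigD1 i) //= lerDl.
by apply: sumr_ge0 => j _; rewrite sqr_ge0.
Qed.

Lemma l2norm_le_norm1 n (x : 'cV[R]_n) : l2norm x <= norm1 x.
Proof.
rewrite -[leRHS]ger0_norm ?norm1_ge0 // -sqrtr_sqr ler_wsqrtr //.
rewrite /norm1 expr2 mulr_suml; apply: ler_sum => i _.
rewrite big_ord1 -real_normK ?num_real // expr2 ler_wpM2l //.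
by have := norm1_entry x i 0.
Qed.

Lemma norm1_le_l2norm n (x : 'cV[R]_n) : norm1 x <= n%:R * l2norm x.
Proof.
have := @norm1_le _ _ x (l2norm x); rewrite mulr1; apply=> i j.
by rewrite ord1 l2norm_ge_entry.
Qed.

Lemma l2norm_mul_le a b (M : 'M[R]_(a, b)) (x : 'cV[R]_b) :
  l2norm (M *m x) <= norm1 M * (b%:R * l2norm x).
Proof.
rewrite (le_trans (l2norm_le_norm1 _)) // (le_trans (norm1M _ _)) //.
by rewrite ler_wpM2l ?norm1_ge0 // norm1_le_l2norm.
Qed.

Lemma l2norm_delta n (i : 'I_n) : l2norm (delta_mx i 0 : 'cV[R]_n) = 1.
Proof.
rewrite /l2norm (bigD1 i) //= big1 => [|j /negPf ne].
  by rewrite mxE !eqxx expr1n addr0 sqrtr1.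
by rewrite mxE ne /= expr0n.
Qed.

Lemma l2norm0 n : l2norm (0 : 'cV[R]_n) = 0.
Proof. by rewrite /l2norm big1 ?sqrtr0 // => i _; rewrite mxE expr0n. Qed.

Lemma spectral_norm_le a b (M : 'M[R]_(a, b)) :
  spectral_norm M <= norm1 M * b%:R.
Proof.
apply: ge_sup => [|_ [x x1 <-]]; first by exists (l2norm (M *m 0)), 0; rewrite // /= l2norm0.
rewrite (le_trans (l2norm_mul_le _ _)) // ler_wpM2l ?norm1_ge0 //.
by rewrite -[leRHS]mulr1 ler_wpM2l.
Qed.

Lemma spectral_norm_entry a b (M : 'M[R]_(a, b)) i j :
  `|M i j| <= spectral_norm M.
Proof.
have -> : M i j = col j M i 0 by rewrite mxE.
rewrite colE (le_trans (l2norm_ge_entry _ _)) //.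
have ub : has_ubound [set l2norm (M *m x) | x in [set x : 'cV[R]_b | l2norm x <= 1]].
  exists (norm1 M * b%:R) => _ [x x1 <-].
  rewrite (le_trans (l2norm_mul_le _ _)) // ler_wpM2l ?norm1_ge0 //.
  by rewrite -[leRHS]mulr1 ler_wpM2l.
by apply: (ub_le_sup ub); exists (delta_mx j 0); rewrite // /= l2norm_delta.
Qed.

Lemma norm1_le_spectral a b (M : 'M[R]_(a, b)) :
  norm1 M <= a%:R * b%:R * spectral_norm M.
Proof. by apply: norm1_le => i j; exact: spectral_norm_entry. Qed.

Lemma linf_norm_ge0 m (v : nat -> 'cV[R]_m) t : 0 <= linf_norm v t.
Proof.
rewrite /linf_norm; elim/big_ind: _ => // [x y x0 _|s _]; first by rewrite le_max x0.
by elim/big_ind: _ => // x y x0 _; rewrite le_max x0.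
Qed.

Lemma linf_norm_ge m (v : nat -> 'cV[R]_m) t s : (1 <= s <= t)%N ->
  norm1 (v s) <= m%:R * linf_norm v t.
Proof.
move=> st; have := @norm1_le _ _ (v s) (linf_norm v t); rewrite mulr1; apply=> i j.
rewrite ord1 (@le_trans _ _ (\big[Num.max/0]_(j < m) `|v s j 0|)) //.
  exact: le_bigmax.
by apply: le_bigmax_seq; rewrite // mem_index_iota ltnS.
Qed.

Lemma linf_norm_le m (v : nat -> 'cV[R]_m) t c : 0 <= c ->
  (forall s j, `|v s j 0| <= c) -> linf_norm v t <= c.
Proof. by move=> c0 vc; apply: bigmax_le => // s _; apply: bigmax_le. Qed.

End EntryNorm.

(** * Kernels as products of matrices *)

Section Kernel.
Variables (R : realType) (np : nat).
Local Notation sched := 'cV[R]_np.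

Lemma map_iota_rcons T (f : nat -> T) a k :
  map f (iota a k.+1) = rcons (map f (iota a k)) (f (a + k)%N).
Proof. by rewrite -addn1 iotaD map_cat cats1. Qed.

Definition unit_vec (i : 'I_np) : sched := delta_mx i 0.

(** The multilinear extension of a function of words to sequences of vectors.  It
gives kernels a recursive form ([irr_kernel_multilin]), which replaces the
sum over tuples in inductions on the length of the schedule. *)
Fixpoint multilin (V : lmodType R) (F : seq 'I_np -> V) (L : seq sched) : V :=
  if L is x :: L' then \sum_i x i 0 *: multilin (fun s => F (i :: s)) L' else F [::].

Lemma multilin_unit (V : lmodType R) (F : seq 'I_np -> V) s :
  multilin F (map unit_vec s) = F s.
Proof.
elim: s F => //= i s IH F; rewrite (bigD1 i) //= big1 => [|j /negPf ne].
  by rewrite IH mxE !eqxx scale1r addr0.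
by rewrite mxE ne scale0r.
Qed.

Lemma sum_tupleS (V : nmodType) k (F : k.+1.-tuple 'I_np -> V) :
  \sum_s F s = \sum_i \sum_(s : k.-tuple 'I_np) F [tuple of i :: s].
Proof.
rewrite pair_big /=.
rewrite (reindex (fun x : 'I_np * k.-tuple 'I_np => [tuple of x.1 :: x.2])) //=.
exists (fun t => (thead t, [tuple of behead t])) => [[i s] _|t _] /=.
  by rewrite theadE; congr pair; apply: val_inj.
by rewrite [RHS]tuple_eta.
Qed.

Lemma sum_tuple_multilin (V : lmodType R) (F : seq 'I_np -> V) (p : nat -> sched) a k :
  \sum_(s : k.-tuple 'I_np)
     (\prod_(i < k) p (a + i.+1)%N (tnth s i) 0) *: F s
  = multilin F [seq p s | s <- iota a.+1 k].
Proof.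
elim: k a F => [|k IH] a F.
  rewrite (big_pred1 [tuple]) => [|s]; first by rewrite big_ord0 scale1r.
  by apply/esym/eqP; rewrite tuple0.
rewrite sum_tupleS /=; apply: eq_bigr => i _.
rewrite -IH scaler_sumr; apply: eq_bigr => s _.
rewrite scalerA big_ord_recl /= addn1; congr (_ * _ *: _).
by apply: eq_bigr => j _; rewrite tnthS addSnnS.
Qed.

Section Sys.
Variables (m ny n : nat) (sys : lpv_ssa R np m ny n).

Lemma lin_comb_unit a b (M : 'I_np -> 'M[R]_(a, b)) i :
  lin_comb M (unit_vec i) = M i.
Proof.
rewrite /lin_comb (bigD1 i) //= big1 => [|j /negPf ne].
  by rewrite mxE !eqxx scale1r addr0.
by rewrite mxE ne scale0r.
Qed.

(** The head of the sequence acts first. *)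
Fixpoint transition_seq (L : seq sched) : 'M[R]_n :=
  if L is x :: L' then transition_seq L' *m lin_comb (lpvA sys) x else 1%:M.

Lemma trans_cat L1 L2 : transition_seq (L1 ++ L2) = transition_seq L2 *m transition_seq L1.
Proof. by elim: L1 => [|x L IH] /=; rewrite ?mulmx1 // IH mulmxA. Qed.

Lemma transition_trans p k : transition sys p k = transition_seq [seq p s | s <- iota 1 k].
Proof.
elim: k => // k IH; rewrite map_iota_rcons -cats1 trans_cat /= IH.
by rewrite mul1mx add1n.
Qed.

(** Variation of constants. *)
Lemma lpv_stateE p v t : lpv_state sys p v t =
  \sum_(1 <= tau < t.+1)
     transition_seq [seq p s | s <- iota tau.+1 (t - tau)] *m lin_comb (lpvB sys) (p tau) *m v tau.
Proof.
elim: t => [|t IH] /=; first by rewrite big_geq.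
rewrite IH [RHS]big_nat_recr //= subnn mul1mx; congr (_ + _).
rewrite mulmx_sumr; apply: eq_big_nat => tau /andP[_ lt].
rewrite subSn // map_iota_rcons -cats1 trans_cat /= mul1mx !mulmxA.
by rewrite addSn subnKC.
Qed.

Definition word_mx (w : seq 'I_np) := transition_seq (map unit_vec w).

Lemma word_mx_cons i w : word_mx (i :: w) = word_mx w *m lpvA sys i.
Proof. by rewrite /word_mx /= lin_comb_unit. Qed.

Definition has_markov_parameters (S : seq 'I_np -> 'M[R]_(ny, m)) :=
  forall q w j, S (q :: rcons w j) = lpvC sys j *m word_mx w *m lpvB sys q.

(** Both sides are linear in each element of the sequence.  The factor [X] absorbs
the leading matrices, which makes the induction go through. *)
Lemma multilin_observation b (F : seq 'I_np -> 'M[R]_(ny, b)) (X : 'M[R]_(n, b)) L y :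
  (forall w j, F (rcons w j) = lpvC sys j *m word_mx w *m X) ->
  multilin F (rcons L y) = lin_comb (lpvC sys) y *m transition_seq L *m X.
Proof.
elim: L F X => [|x L IH] F X FX.
  rewrite /= mulmx1 mulmx_suml; apply: eq_bigr => j _.
  by rewrite -[[:: j]]/(rcons [::] j) FX mulmx1 scalemxAl.
rewrite /= mulmxA -mulmxA [lin_comb (lpvA _) _ *m _]mulmx_suml mulmx_sumr.
apply: eq_bigr => i _; rewrite (IH _ (lpvA sys i *m X)) => [|w j].
  by rewrite -scalemxAl -scalemxAr.
by rewrite -rcons_cons FX word_mx_cons !mulmxA.
Qed.

Lemma multilin_markov S x L y : has_markov_parameters S ->
  multilin S (x :: rcons L y) =
  lin_comb (lpvC sys) y *m transition_seq L *m lin_comb (lpvB sys) x.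
Proof.
move=> SE; rewrite /= [lin_comb (lpvB _) _]/lin_comb mulmx_sumr.
by apply: eq_bigr => q _; rewrite (multilin_observation (X := lpvB sys q)) // scalemxAr.
Qed.

End Sys.

Lemma irr_kernel_multilin m ny (S : seq 'I_np -> 'M[R]_(ny, m)) p t tau :
  (1 <= tau <= t)%N ->
  irr_kernel S p t tau = multilin S [seq p s | s <- iota tau (t - tau).+1].
Proof.
case/andP; case: tau => // tau _ lt; rewrite -sum_tuple_multilin.
(* The offset t - (t - tau).+1 in sched_prod equals tau - 1 as 1 <= tau <= t. *)
by rewrite /irr_kernel /sched_prod -subSn // subSS subKn 1?ltnW.
Qed.

Lemma irr_kernel_markov m ny n (sys : lpv_ssa R np m ny n) S p t tau :
  has_markov_parameters sys S -> (1 <= tau < t)%N ->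
  irr_kernel S p t tau = lin_comb (lpvC sys) (p t)
    *m transition_seq sys [seq p s | s <- iota tau.+1 (t.-1 - tau)] *m lin_comb (lpvB sys) (p tau).
Proof.
move=> SE /andP[t0 lt]; rewrite irr_kernel_multilin ?t0 1?ltnW //=.
case: t lt => // t; rewrite ltnS /= => le.
rewrite subSn // map_iota_rcons -(multilin_markov _ _ _ SE).
by rewrite addSn subnKC.
Qed.

(** A prescribed sequence of scheduling values as a schedule starting at time 1;
past its end the schedule stays in the set that contains [x]. *)
Lemma irr_kernel_seq m ny (S : seq 'I_np -> 'M[R]_(ny, m)) x L :
  irr_kernel S (fun s => nth x (x :: L) s.-1) (size L).+1 1 = multilin S (x :: L).
Proof.
rewrite irr_kernel_multilin // subn1; congr multilin.
apply: (@eq_from_nth _ x) => [|i]; rewrite size_map size_iota // => ls.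
by rewrite (nth_map 0%N) ?size_iota // nth_iota.
Qed.

End Kernel.

(** * Spanning sets and Hankel realizations *)

Lemma eq_cols (T : Type) a b (A B : 'M[T]_(a, b)) :
  (forall j, col j A = col j B) -> A = B.
Proof. by move=> AB; apply/matrixP => i j; have /colP /(_ i) := AB j; rewrite !mxE. Qed.

Section Spanning.
Variable R : realType.

(** A matrix of maximal rank with rows in [F] has full rank: a nonzero vector
killed by its rows would be moved by some element of [F], and adding that
element as a row would increase the rank. *)
Lemma finite_spanning n (F : set 'rV[R]_n) :
  (forall x : 'cV[R]_n, (forall u, F u -> u *m x = 0) -> x = 0) ->
  exists K (M : 'M[R]_(K, n)), (forall i, F (row i M)) /\ row_full M.
Proof.
move=> F0.
pose Q k := `[< exists K (M : 'M[R]_(K, n)), (forall i, F (row i M)) /\ \rank M = k >].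
have Qex : exists k, Q k.
  by exists 0%N; apply/asboolP; exists 0%N, 0; split; [case | rewrite mxrank0].
have Qub k : Q k -> (k <= n)%N.
  by move=> /asboolP [K [M [_ <-]]]; exact: rank_leq_col.
case: (ex_maxnP Qex Qub) => k /asboolP [K [M [FM rM]]] kmax.
exists K, M; split => //.
suff MC : cokermx M = 0.
  by rewrite /row_full eqn_leq rank_leq_col -subn_eq0 -mxrank_coker MC mxrank0.
apply: eq_cols => j; rewrite col0; apply: F0 => u Fu.
have : Q (\rank (col_mx u M)).
  apply/asboolP; exists (1 + K)%N, (col_mx u M); split => // i.
  case: (split_ordP i) => i' ->; last by rewrite rowKd.
  by rewrite rowKu ord1 [row _ _](_ : _ = u) //; apply/rowP => ?; rewrite mxE.
move=> /kmax; rewrite -rM => le.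
have : (u <= M)%MS.
  have sM : (M <= col_mx u M)%MS by rewrite -addsmxE addsmxSr.
  have h : (col_mx u M <= M)%MS by rewrite -(geq_leqif (mxrank_leqif_sup sM)).
  by rewrite (submx_trans _ h) // -addsmxE addsmxSl.
by move=> /submxP [D ->]; rewrite -mulmxA colE [M *m _]mulmxA mulmx_coker mul0mx mulmx0.
Qed.

Lemma lin_span_mem (V : lmodType R) (F : set V) x : F x -> lin_span F x.
Proof.
by move=> Fx; exists 1%N, (fun=> 1), (fun=> x); rewrite big_ord1 scale1r.
Qed.

Lemma lin_span_range (V : lmodType R) r (b : 'I_r -> V) x :
  lin_span (range b) x -> exists a : 'cV[R]_r, x = \sum_i a i 0 *: b i.
Proof.
move=> [k [c [f [fb ->]]]].
have /choice [g gf] : forall j, exists i, b i = f j.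
  by move=> j; have [i _ <-] := fb j; exists i.
exists (\col_i \sum_(j | g j == i) c j).
rewrite (partition_big g predT) //=; apply: eq_bigr => i _.
rewrite mxE scaler_suml; apply: eq_bigr => j /eqP <-.
by rewrite gf.
Qed.

End Spanning.

Section Hankel.
Variables (R : realType) (np m ny : nat) (S : seq 'I_np -> 'M[R]_(ny, m)).
Local Notation word := (seq 'I_np).
Local Notation vec := 'cV[R]_(\sum_(j < np) ny).

(** The values at [w] of a family of functions, as the columns of a matrix. *)
Definition fun_mx r (b : 'I_r -> word -> vec) (w : word) :
    'M[R]_(\sum_(j < np) ny, r) :=
  \matrix_(k, i) b i w k 0.

Lemma fun_mxE r (b : 'I_r -> word -> vec) (a : 'cV[R]_r) w :
  (\sum_i a i 0 *: b i) w = fun_mx b w *m a.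
Proof.
rewrite fct_sumE; apply/colP => k; rewrite summxE mxE.
by apply: eq_bigr => i _; rewrite !mxE mulrC.
Qed.

Definition hankel_functions : set (word -> vec) :=
  [set f | exists v q l, f = (fun w => psi S q l (v ++ w))].

Lemma hankel_shift q f : lin_span hankel_functions f ->
  lin_span hankel_functions (fun w => f (q :: w)).
Proof.
move=> [k [c [g [gH ->]]]]; exists k, c, (fun i w => g i (q :: w)); split => [i|].
  have [v [q' [l ->]]] := gH i; exists (rcons v q), q', l.
  by apply/funext => w; rewrite cat_rcons.
by apply/funext => w; rewrite !fct_sumE.
Qed.

(** The span of the Hankel functions is the state space, in coordinates with respect
to a basis [b]: [A_q] is the shift [f |-> f (q :: _)], [B_q] lists the functions
[psi S q l], and [C_j] takes the [j]-th block of the value at the empty word. *)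
Lemma canonical_realization r : hankel_rank_is S r ->
  exists sys : lpv_ssa R np m ny r, has_markov_parameters sys S.
Proof.
move=> [b [_ Wb]].
have coord f : lin_span hankel_functions f ->
    exists a : 'cV[R]_r, forall w, f w = fun_mx b w *m a.
  move=> Wf; have [|a ->] := @lin_span_range _ _ r b f; first by rewrite -Wb.
  by exists a => w; rewrite fun_mxE.
have bW i : lin_span hankel_functions (b i).
  by rewrite /hankel_functions Wb; apply: lin_span_mem; exists i.
have /choice [a aE] : forall qi : 'I_np * 'I_r, exists a : 'cV[R]_r,
    forall w, b qi.2 (qi.1 :: w) = fun_mx b w *m a.
  by move=> [q i]; apply: coord; exact: hankel_shift.
have /choice [d dE] : forall ql : 'I_np * 'I_m, exists a : 'cV[R]_r,
    forall w, psi S ql.1 ql.2 w = fun_mx b w *m a.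
  by move=> [q l]; apply: (coord (psi S q l)); apply: lin_span_mem; exists [::], q, l.
pose sys := LpvSsa (fun q => \matrix_(k, i) a (q, i) k 0)
  (fun q => \matrix_(k, l) d (q, l) k 0)
  (fun j => submxcol (fun_mx b [::]) j : 'M[R]_(ny, r)).
exists sys => q w j.
have bE w' : fun_mx b w' = fun_mx b [::] *m word_mx sys w'.
  elim: w' => [|p w' IH]; first by rewrite mulmx1.
  rewrite word_mx_cons mulmxA -IH; apply/matrixP => k i.
  by rewrite mxE (aE (p, i)) !mxE; apply: eq_bigr => h _; rewrite !mxE.
apply: eq_cols => l; rewrite [RHS]colE -mulmxA -colE.
have -> : col l (S (q :: rcons w j)) = submxcol (psi S q l w) j by rewrite mxcolK.
rewrite (dE (q, l)) bE -!submxcol_mul; congr (_ *m _).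
by apply/colP => k; rewrite !mxE.
Qed.

(** Reachability from 0 and observability, in dual form: no nonzero linear form
vanishes on the reachable states, and no nonzero state has zero output along all
words. *)
Definition reachable n (sys : lpv_ssa R np m ny n) :=
  forall u : 'rV[R]_n, (forall v q, u *m word_mx sys v *m lpvB sys q = 0) -> u = 0.

Definition observable n (sys : lpv_ssa R np m ny n) :=
  forall x : 'cV[R]_n, (forall w j, lpvC sys j *m word_mx sys w *m x = 0) -> x = 0.

(** Each basis function of the Hankel space is the observation of a reachable state.
These [r] states are independent since their observations are, hence [n = r] and
they form a basis of the state space, on which the observation map is
injective. *)
Lemma small_realization_reachable_observable r n (sys : lpv_ssa R np m ny n) :
  hankel_rank_is S r -> has_markov_parameters sys S -> (n <= r)%N ->
  reachable sys /\ observable sys.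
Proof.
move=> [b [bfree Wb]] SE nr.
pose obs w : 'M[R]_(\sum_(j < np) ny, n) := \mxcol_j (lpvC sys j *m word_mx sys w).
have psiE v q l w : psi S q l (v ++ w) = obs w *m (word_mx sys v *m col l (lpvB sys q)).
  rewrite /obs mxcol_mul; apply: eq_mxcol => j.
  by rewrite SE /word_mx map_cat trans_cat !colE !mulmxA.
(* Membership in the reachable space is expressed by orthogonality. *)
have /choice [x xE] : forall i, exists x : 'cV[R]_n, (forall w, b i w = obs w *m x) /\
    forall u : 'rV_n, (forall v q, u *m word_mx sys v *m lpvB sys q = 0) -> u *m x = 0.
  move=> i; have : lin_span hankel_functions (b i).
    by rewrite /hankel_functions Wb; apply: lin_span_mem; exists i.
  move=> [k [c [f [fH bi]]]].
  have /choice [y yE] : forall j, exists y : 'cV[R]_n, (forall w, f j w = obs w *m y) /\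
    forall u : 'rV_n, (forall v q, u *m word_mx sys v *m lpvB sys q = 0) -> u *m y = 0.
    move=> j; have [v [q [l fj]]] := fH j.
    exists (word_mx sys v *m col l (lpvB sys q)); split => [w|u u0].
      by rewrite fj psiE.
    by rewrite colE !mulmxA u0 mul0mx.
  exists (\sum_j c j *: y j); split => [w|u u0].
    rewrite bi fct_sumE mulmx_sumr; apply: eq_bigr => j _.
    by rewrite -scalemxAr -(yE j).1.
  rewrite mulmx_sumr big1 // => j _.
  by rewrite -scalemxAr (yE j).2 // scaler0.
pose X : 'M[R]_(n, r) := \matrix_(k, i) x i k 0.
have bX w : fun_mx b w = obs w *m X.
  apply/matrixP => k i; rewrite mxE (xE i).1 !mxE.
  by apply: eq_bigr => h _; rewrite !mxE.
have obs0 (a : 'cV_r) : (forall w, obs w *m (X *m a) = 0) -> a = 0.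
  move=> a0; apply/colP => i; rewrite mxE; move: i; apply: bfree.
  by apply/funext => w; rewrite fun_mxE bX -mulmxA a0.
have rX : \rank X = r.
  suff C0 : cokermx X = 0.
    by apply/eqP; rewrite eqn_leq rank_leq_col -subn_eq0 -mxrank_coker C0 mxrank0.
  apply: eq_cols => j; rewrite col0; apply: obs0 => w.
  by rewrite colE [X *m _]mulmxA mulmx_coker mul0mx mulmx0.
have fX : row_free X by rewrite /row_free eqn_leq rank_leq_row rX.
split=> [u u0|y y0].
  apply: (row_free_inj fX); rewrite mul0mx; apply/rowP => i.
  have /rowP /(_ 0) := (xE i).2 u u0; rewrite !mxE => ux0; rewrite -[RHS]ux0.
  by apply: eq_bigr => h _; rewrite !mxE.
have yX : y = X *m (pinvmx X *m y) by rewrite mulmxA mulmxVp // mul1mx.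
rewrite yX [_ *m y]obs0 ?mulmx0 // => w; rewrite -yX mxcol_mul.
by rewrite -[RHS]mxcol0; apply: eq_mxcol => j; rewrite y0.
Qed.

End Hankel.

(** * Realizations and Markov parameters *)

Section Response.
Variables (R : realType) (np m ny : nat) (P : set 'cV[R]_np).
Variable H : response R np m ny.
Local Notation irr := (is_irr P H).

Lemma sched_extension t p : (1 <= t)%N -> in_sched P t p ->
  exists2 p', in_sched_inf P p' & forall s, (s <= t)%N -> p' s = p s.
Proof.
move=> t1 Pp; exists (fun s => p (minn s t)) => s s1.
  by apply: Pp; rewrite leq_min s1 t1 geq_minr.
by rewrite (minn_idPl s1).
Qed.

Lemma word_ext (p p' : nat -> 'cV[R]_np) (v : nat -> 'cV[R]_m) t :
  (forall s, (s <= t)%N -> p' s = p s) -> word p v t = word p' v t.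
Proof.
move=> p'E; apply/eq_in_map => s; rewrite mem_iota add1n ltnS => /andP[_ st].
by rewrite p'E.
Qed.

(** [is_irr] speaks of infinite schedules; a finite one is prolonged by its last
value. *)
Lemma irr_finite S t p v : irr S -> (1 <= t)%N -> in_sched P t p ->
  H (word p v t) = \sum_(1 <= tau < t) irr_kernel S p t tau *m v tau.
Proof.
move=> HS t1 Pp; have [p' Pp' p'E] := sched_extension t1 Pp.
rewrite (word_ext v p'E) HS //.
apply: eq_big_nat => tau /andP[tau1 lt].
rewrite !irr_kernel_multilin ?tau1 1?ltnW //; congr (multilin _ _ *m _).
apply/eq_in_map => s; rewrite mem_iota addnS subnKC ?(ltnW lt) // ltnS.
by move=> /andP[_ st]; rewrite p'E.
Qed.

Definition impulse (tau : nat) (x : 'cV[R]_m) (s : nat) := if s == tau then x else 0.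

Lemma irr_impulse S t p tau x : irr S -> (1 <= tau < t)%N -> in_sched P t p ->
  H (word p (impulse tau x) t) = irr_kernel S p t tau *m x.
Proof.
move=> HS /andP[tau1 lt] Pp; rewrite (irr_finite _ HS) //; last first.
  by rewrite (leq_trans tau1) // ltnW.
rewrite (bigD1_seq tau) ?iota_uniq ?mem_index_iota ?tau1 //= big1 ?addr0.
  by rewrite /impulse eqxx.
by move=> s /negPf ne; rewrite /impulse ne mulmx0.
Qed.

Lemma output_sum n (sys : lpv_ssa R np m ny n) S p v t :
  has_markov_parameters sys S -> (1 <= t)%N ->
  lin_comb (lpvC sys) (p t) *m lpv_state sys p v t.-1 =
  \sum_(1 <= tau < t) irr_kernel S p t tau *m v tau.
Proof.
move=> SE; case: t => // t _; rewrite lpv_stateE mulmx_sumr.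
apply: eq_big_nat => tau taut.
by rewrite (irr_kernel_markov _ SE) // !mulmxA.
Qed.

Lemma markov_realizes n (sys : lpv_ssa R np m ny n) S :
  irr S -> has_markov_parameters sys S -> realizes P H sys.
Proof.
move=> HS SE t p v t1 Pp.
by rewrite (output_sum _ _ SE) // (irr_finite _ HS).
Qed.

Hypothesis P_unit : forall i : 'I_np, P (unit_vec R i).

(** At unit vectors the kernel takes the value [S (q :: rcons w j)], and impulses
read it off from [H]. *)
Lemma irr_unique S S' q w j : irr S -> irr S' ->
  S (q :: rcons w j) = S' (q :: rcons w j).
Proof.
move=> HS HS'; apply: eq_cols => l; rewrite !colE.
pose L := map (@unit_vec R np) (rcons w j); pose x := @unit_vec R np q.
have E (S0 : seq 'I_np -> 'M[R]_(ny, m)) : S0 (q :: rcons w j) =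
    irr_kernel S0 (fun s => nth x (x :: L) s.-1) (size L).+1 1.
  by rewrite irr_kernel_seq -(multilin_unit S0).
have Pp : in_sched P (size L).+1 (fun s => nth x (x :: L) s.-1).
  move=> s s_le.
  have /mapP [i _ ->] : nth x (x :: L) s.-1 \in map (@unit_vec R np) (q :: rcons w j).
    by apply: mem_nth; case: s s_le.
  exact: P_unit.
have lt : (1 <= 1 < (size L).+1)%N by rewrite /L size_map size_rcons.
by rewrite !E -(irr_impulse _ HS lt Pp) -(irr_impulse _ HS' lt Pp).
Qed.

(** [C_j A_w B_q] at the word [q :: rcons w j]. *)
Definition sys_markov n (sys : lpv_ssa R np m ny n) (s : seq 'I_np) : 'M[R]_(ny, m) :=
  if s is q :: s' then
    if rev s' is j :: w then lpvC sys j *m word_mx sys (rev w) *m lpvB sys q else 0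
  else 0.

(** The Markov parameters of a realization are another impulse response
representation of [H], so they agree with [S]. *)
Lemma realizes_markov n (sys : lpv_ssa R np m ny n) S :
  irr S -> realizes P H sys -> has_markov_parameters sys S.
Proof.
move=> HS Hsys q w j.
have SE : has_markov_parameters sys (sys_markov sys) by move=> ? ? ?; rewrite /sys_markov rev_rcons revK.
rewrite (irr_unique _ _ _ HS (S' := sys_markov sys)) ?SE // => p v t Pp t1.
rewrite -(output_sum _ _ SE) // Hsys // => s /andP[s1 _]; exact: Pp.
Qed.

End Response.

(** * Transfer of decay between kernels and transition matrices *)

Section Decay.
Variables (R : realType) (np m ny : nat) (P : set 'cV[R]_np).
Hypothesis P_simplex : P `<=` @simplex R np.
Hypothesis P_unit : forall i : 'I_np, P (unit_vec R i).
Implicit Types (S : seq 'I_np -> 'M[R]_(ny, m)) (L : seq 'cV[R]_np).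

Definition kernel_bound S (g : nat -> R) :=
  forall N p tau, (1 <= N)%N -> (1 <= tau)%N -> in_sched_inf P p ->
  norm1 (irr_kernel S p (N + tau) tau) <= g N.

Definition trans_bound n (sys : lpv_ssa R np m ny n) (g : nat -> R) :=
  forall L, (forall x, x \in L -> P x) -> norm1 (transition_seq sys L) <= g (size L).

Lemma kernel_bound_seq n (sys : lpv_ssa R np m ny n) S g x L y :
  has_markov_parameters sys S -> kernel_bound S g -> P x -> P y -> (forall z, z \in L -> P z) ->
  norm1 (lin_comb (lpvC sys) y *m transition_seq sys L *m lin_comb (lpvB sys) x)
    <= g (size L).+1.
Proof.
move=> SE Sg Px Py PL; rewrite -(multilin_markov _ _ _ SE) -irr_kernel_seq.
have := Sg (size (rcons L y)) (fun s => nth x (x :: rcons L y) s.-1) 1%N.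
rewrite addn1 size_rcons; apply => // s s1.
have [lt|ge] := ltnP s.-1 (size (x :: rcons L y)); last by rewrite nth_default.
have := mem_nth x lt; rewrite inE mem_rcons inE => /or3P [/eqP ->|/eqP ->|] //.
exact: PL.
Qed.

(** Reachability and observability give matrices [N^T] and [M], built from columns of
[A_v B_q] and rows of [C_j A_w], with a right inverse [E^T] and a left inverse [D].
Then [T = D (M T N^T) E^T], and the entries of [M T N^T] are entries of kernels
of length greater than that of [T]. *)
Lemma kernel_bound_trans n (sys : lpv_ssa R np m ny n) S g :
  has_markov_parameters sys S -> reachable sys -> observable sys -> kernel_bound S g ->
  (forall i j, (i <= j)%N -> g j <= g i) ->
  exists2 K, 0 <= K & trans_bound sys (fun k => K * g k.+1).
Proof.
move=> SE reach obs Sg gmono.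
have [|a [M [MF /row_fullP [D DM]]]] := @finite_spanning R n
  [set u | exists w j i, u = row i (lpvC sys j *m word_mx sys w)].
  move=> x x0; apply: obs => w j; apply/row_matrixP => i.
  by rewrite row_mul row0 x0 //; exists w, j, i.
have [|b [N [NF /row_fullP [E EN]]]] := @finite_spanning R n
  [set u | exists v q l, u = (col l (word_mx sys v *m lpvB sys q))^T].
  move=> x x0; apply: trmx_inj; rewrite trmx0; apply: reach => v q.
  apply: eq_cols => l; rewrite col0 -mulmxA colE -mulmxA -colE.
  by apply: trmx_inj; rewrite trmx_mul trmxK trmx0 x0 //; exists v, q, l.
have c0 : 0 <= a%:R * b%:R :> R by rewrite mulr_ge0.
exists (norm1 D * (a%:R * b%:R) * norm1 E^T) => [|L PL].
  by rewrite !mulr_ge0 ?norm1_ge0.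
have -> : transition_seq sys L = D *m (M *m transition_seq sys L *m N^T) *m E^T.
  by rewrite !mulmxA DM mul1mx -mulmxA -trmx_mul EN trmx1 mulmx1.
rewrite (le_trans (norm1M _ _)) // mulrAC ler_wpM2r ?norm1_ge0 //.
rewrite (le_trans (norm1M _ _)) // -mulrA ler_wpM2l ?norm1_ge0 //.
apply: norm1_le => i j.
have [w [k [i' Mi]]] := MF i; have [v [q [l Nj]]] := NF j.
have -> : (M *m transition_seq sys L *m N^T) i j =
    (lpvC sys k *m word_mx sys w *m transition_seq sys L *m (word_mx sys v *m lpvB sys q)) i' l.
  transitivity ((row i M *m transition_seq sys L *m col j N^T) 0 0).
    by rewrite colE mulmxA -colE -!row_mul !mxE.
  by rewrite Mi -tr_row Nj trmxK [col l _]colE mulmxA -colE -!row_mul !mxE.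
rewrite (le_trans (norm1_entry _ _ _)) //.
pose L' := map (@unit_vec R np) v ++ L ++ map (@unit_vec R np) w.
have -> : lpvC sys k *m word_mx sys w *m transition_seq sys L *m (word_mx sys v *m lpvB sys q) =
    lin_comb (lpvC sys) (unit_vec R k) *m transition_seq sys L' *m lin_comb (lpvB sys) (unit_vec R q).
  by rewrite !lin_comb_unit !trans_cat !mulmxA.
rewrite (le_trans (kernel_bound_seq SE Sg _ _ _)) //; last first.
  by apply: gmono; rewrite ltnS !size_cat addnCA leq_addr.
by move=> x; rewrite !mem_cat => /or3P [/mapP [? _ ->]|/PL|/mapP [? _ ->]].
Qed.

Lemma norm1_lin_comb a b (M : 'I_np -> 'M[R]_(a, b)) p :
  P p -> norm1 (lin_comb M p) <= \sum_i norm1 (M i).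
Proof.
move=> /P_simplex [p01 _]; rewrite (le_trans (norm1_sum _ _)) //.
apply: ler_sum => i _; rewrite norm1Z; have /andP[p0 p1] := p01 i.
by rewrite ger0_norm // ler_piMl ?norm1_ge0.
Qed.

Lemma trans_bound_kernel n (sys : lpv_ssa R np m ny n) S D beta :
  has_markov_parameters sys S -> 0 <= D -> 0 < beta -> trans_bound sys (fun k => D * beta ^+ k) ->
  exists2 c, 0 <= c & kernel_bound S (fun N => c * beta ^+ N.-1).
Proof.
move=> SE D0 b0 TD.
exists ((\sum_i norm1 (lpvC sys i)) * D * (\sum_i norm1 (lpvB sys i))).
  by rewrite !mulr_ge0 //; apply: sumr_ge0 => i _; exact: norm1_ge0.
move=> N p tau N1 tau1 Pp.
rewrite (irr_kernel_markov _ SE); last by rewrite tau1 -[ltnLHS]add0n ltn_add2r.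
rewrite (le_trans (norm1M _ _)) // mulrAC ler_pM ?norm1_ge0 ?norm1_lin_comb //; last first.
  exact: Pp.
rewrite (le_trans (norm1M _ _)) // -mulrA ler_pM ?norm1_ge0 ?norm1_lin_comb //.
  by apply: Pp; rewrite (leq_trans tau1) // leq_addl.
have -> : N.-1 = size [seq p s | s <- iota tau.+1 ((N + tau).-1 - tau)].
  by rewrite size_map size_iota -{2}(prednK N1) addSn /= addnK.
apply: TD => x /mapP [s]; rewrite mem_iota => /andP[s1 _] ->.
by apply: Pp; rewrite (leq_trans tau1) // ltnW.
Qed.

(** The rate is taken as [beta = 1 - 1 / (2 k)], so that [beta ^ k >= 1/2] by
Bernoulli's inequality and no root of 1/2 is needed.  Cutting off blocks of
length [k] then gains a factor [beta ^ k] each; the factor 2 makes up for the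
incomplete last block. *)
Lemma trans_bound_geometric n (sys : lpv_ssa R np m ny n) D k :
  (0 < k)%N -> 0 <= D -> trans_bound sys (fun=> D) ->
  (forall L, (forall x, x \in L -> P x) -> size L = k -> norm1 (transition_seq sys L) <= 2^-1) ->
  exists2 beta, 0 < beta < 1 &
    trans_bound sys (fun j => 2 * D * beta ^+ j).
Proof.
move=> k0 D0 TD Tk; pose e : R := (2 * k%:R)^-1.
have kR : 1 <= k%:R :> R by rewrite ler1n.
have e0 : 0 < e by rewrite invr_gt0 mulr_gt0 // ltr0n.
have e1 : e <= 2^-1 by rewrite lef_pV2 ?posrE ?mulr_gt0 ?ltr0n // ler_peMr.
pose beta := 1 - e.
have b0 : 0 < beta by rewrite subr_gt0 (le_lt_trans e1) // invf_lt1 ?ltr1n.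
have b1 : beta < 1 by rewrite ltrBlDr ltrDl.
have bern j : 1 - j%:R * e <= beta ^+ j.
  elim: j => [|j IH]; first by rewrite mul0r subr0 expr0.
  rewrite exprSr; have := ler_wpM2r (ltW b0) IH; apply: le_trans.
  rewrite /beta -natr1.
  suff : 0 <= j%:R * e * e by nra.
  by rewrite !mulr_ge0 // ltW.
have bk : 2^-1 <= beta ^+ k.
  apply: le_trans (bern k); rewrite /e invfM mulrCA mulfV ?mulr1; last first.
    by rewrite pnatr_eq0 -lt0n.
  lra.
exists beta; first by rewrite b0.
move=> L; have [l] := ubnP (size L); elim: l L => // l IH L; rewrite ltnS => Ll PL.
have [lt|ge] := ltnP (size L) k.
  apply: (le_trans (TD _ PL)); rewrite mulrAC ler_peMl //.
  have : beta ^+ k <= beta ^+ size L by rewrite ler_wiXn2l ?(ltW b0) ?(ltW b1) ?(ltnW lt).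
  move: bk; lra.
rewrite -{1}(cat_take_drop k L) trans_cat (le_trans (norm1M _ _)) //.
have dropL : size (drop k L) = (size L - k)%N by rewrite size_drop.
have tL : norm1 (transition_seq sys (take k L)) <= beta ^+ k.
  apply: le_trans bk; apply: Tk => [x /mem_take /PL //|].
  by rewrite size_take_min (minn_idPl ge).
have dL : norm1 (transition_seq sys (drop k L)) <= 2 * D * beta ^+ (size L - k).
  rewrite -dropL; apply: IH => [|x /mem_drop /PL //].
  by rewrite dropL (leq_trans _ Ll) // ltn_subrL k0 (leq_trans k0 ge).
rewrite -(subnK ge) exprD mulrA.
by rewrite ler_pM ?norm1_ge0.
Qed.

(** The summand with [norm1 1%:M] takes care of the empty product, which
[gues_rate] leaves out. *)
Lemma gues_rate_trans n (sys : lpv_ssa R np m ny n) beta : 0 < beta ->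
  gues_rate P sys beta ->
  exists2 D, 0 <= D & trans_bound sys (fun k => D * beta ^+ k).
Proof.
move=> b0 [C C1 HC].
have nC : 0 <= n%:R * n%:R * C by rewrite !mulr_ge0 // (le_trans _ C1).
exists (norm1 (1%:M : 'M[R]_n) + n%:R * n%:R * C) => [|L PL].
  by rewrite addr_ge0 ?norm1_ge0.
case: L PL => [|x L] PL; first by rewrite expr0 mulr1 lerDl.
pose p s := nth x (x :: L) s.-1.
have E : [seq p s | s <- iota 1 (size (x :: L))] = x :: L.
  apply: (@eq_from_nth _ x) => [|i]; rewrite size_map size_iota // => lt.
  by rewrite (nth_map 0%N) ?size_iota // nth_iota.
rewrite -[X in transition_seq _ X]E -transition_trans mulrDl.
rewrite (le_trans (norm1_le_spectral _)) // -[leLHS]add0r lerD //.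
  by rewrite mulr_ge0 ?norm1_ge0 // exprn_ge0 // ltW.
rewrite -[leRHS]mulrA ler_wpM2l ?mulr_ge0 // ltW // HC // => s /andP[s1 ss].
by apply: PL; apply: mem_nth; case: s s1 ss.
Qed.

Lemma trans_gues_rate n (sys : lpv_ssa R np m ny n) beta D : 0 < beta -> 0 <= D ->
  trans_bound sys (fun k => D * beta ^+ k) -> gues_rate P sys beta.
Proof.
move=> b0 D0 TD; exists (D * n%:R + 1); first by rewrite lerDr mulr_ge0.
move=> k p k0 Pp; rewrite (le_lt_trans (spectral_norm_le _)) //.
have bk : 0 < beta ^+ k by rewrite exprn_gt0.
have : norm1 (transition sys p k) <= D * beta ^+ k.
  have := TD [seq p s | s <- iota 1 k].
  rewrite size_map size_iota transition_trans; apply => x /mapP [s].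
  by rewrite mem_iota add1n ltnS => sk ->; exact: Pp.
move=> /(ler_wpM2r (ler0n R n)) h; rewrite (le_lt_trans h) //.
by rewrite mulrDl mul1r mulrAC ltrDl.
Qed.

Lemma irr_ued_kernel_bound S beta : irr_ued P S beta ->
  exists2 c, 0 <= c & kernel_bound S (fun N => c * beta ^+ N.-1).
Proof.
move=> [C C0 HC]; have Cge := ltW C0.
exists (ny%:R * m%:R * C) => [|N p tau]; first by rewrite !mulr_ge0.
move=> N1 tau1 Pp.
rewrite (le_trans (norm1_le_spectral _)) // -[leRHS]mulrA ler_wpM2l ?mulr_ge0 //.
rewrite -lee_fin ltW // (le_lt_trans _ (HC N N1)) //.
by apply: ereal_sup_ubound; exists p, tau.
Qed.

Lemma kernel_bound_irr_ued S beta c : 0 < beta -> 0 <= c ->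
  kernel_bound S (fun N => c * beta ^+ N.-1) -> irr_ued P S beta.
Proof.
move=> b0 c0 Sc; exists (c * m%:R + 1) => [|N N1].
  by rewrite ltr_wpDl ?mulr_ge0.
apply: (@le_lt_trans _ _ (c * m%:R * beta ^+ N.-1)%:E).
  apply: ge_ereal_sup => _ [p [tau [Pp tau1 ->]]]; rewrite lee_fin.
  rewrite (le_trans (spectral_norm_le _)) // mulrAC ler_wpM2r //.
  exact: Sc.
by rewrite lte_fin ltr_pM2r ?exprn_gt0 // ltrDl.
Qed.

(** * Forgetting *)

Section Forgetting.
Variables (H : response R np m ny) (S : seq 'I_np -> 'M[R]_(ny, m)).
Hypothesis H_irr : is_irr P H S.

(** An impulse at time [tau] vanishes at the last [N] instants up to [N + tau], so
it is compared with the zero input at the price [G N]. *)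
Lemma forgetting_kernel_bound G : forgetting_bound P H G ->
  kernel_bound S (fun N => ny%:R * m%:R * G N).
Proof.
move=> [Gdec Glim HG] N p tau N1 tau1 Pp.
have Gdecr i j : (i <= j)%N -> G j <= G i by rewrite -Gdec.
have G0 k : 0 <= G k.
  have : nonincreasing_seq G by move=> i j; exact: Gdecr.
  move/nonincreasing_cvgn_ge => h; have := h (cvgP _ Glim) k.
  by rewrite (cvg_lim _ Glim).
apply: norm1_le => i j.
have Pt : in_sched P (N + tau) p by move=> s /andP[s1 _]; exact: Pp.
have lt : (1 <= tau < N + tau)%N by rewrite tau1 -[ltnLHS]add0n ltn_add2r.
have agree s : (N + tau - N + 1 <= s <= N + tau)%N ->
    impulse tau (delta_mx j 0 : 'cV[R]_m) s = impulse tau 0 s.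
  by rewrite addKn addn1 => /andP[ts _]; rewrite /impulse gtn_eqF.
have t1 : (1 <= N + tau)%N by rewrite (leq_trans N1) // leq_addr.
have [_] := HG _ p N _ _ t1 Pt (leq_addr _ _) agree.
rewrite !(irr_impulse _ H_irr) // mulmx0 subr0 -colE => h.
have := l2norm_ge_entry (col j (irr_kernel S p (N + tau) tau)) i.
rewrite mxE => /le_trans; apply; apply: (le_trans h).
rewrite -[leRHS]mulr1 ler_wpM2l // linf_norm_le // => s k.
rewrite /impulse; case: eqP => _; rewrite !mxE ?subr0 ?normr0 //.
by rewrite normr_nat; case: (_ && _).
Qed.

(** The left-hand side telescopes. *)
Lemma geometric_tail (beta : R) k d : 0 < beta < 1 ->
  (1 - beta) * (\sum_(1 <= tau < d.+1) beta ^+ (k + d - tau)) <= beta ^+ k.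
Proof.
move=> /andP[b0 b1].
suff -> : (1 - beta) * (\sum_(1 <= tau < d.+1) beta ^+ (k + d - tau)) =
    beta ^+ k - beta ^+ (k + d) by rewrite gerBl exprn_ge0 // ltW.
elim: d => [|d IH]; first by rewrite big_geq // mulr0 addn0 subrr.
rewrite big_nat_recl // mulrDr.
rewrite (eq_big_nat _ _ (F2 := fun tau => beta ^+ (k + d - tau))); last first.
  by move=> i _; rewrite addnS subSS.
by rewrite IH addnS subn1 /= exprS; ring.
Qed.

Lemma kernel_sum_bound beta c p v t k : 0 < beta < 1 -> 0 <= c ->
  kernel_bound S (fun N => c * beta ^+ N.-1) ->
  (k <= t)%N -> in_sched_inf P p ->
  (forall s, (t - k + 1 <= s <= t)%N -> v s = 0) ->
  norm1 (\sum_(1 <= tau < t) irr_kernel S p t tau *m v tau)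
    <= c * m%:R / (beta * (1 - beta)) * beta ^+ k * linf_norm v t.
Proof.
move=> b01 c0 Sc kt Pp v0; have /andP[b0 b1] := b01.
have l0 := linf_norm_ge0 v t.
(* Dividing by beta turns the exponents t - tau - 1 into t - tau, which start at k
   when only the tau <= t - k contribute. *)
pose A := c * m%:R / beta * linf_norm v t.
have A0 : 0 <= A by rewrite !mulr_ge0 // invr_ge0 ltW.
rewrite (le_trans (norm1_sum _ _)) //.
apply: (@le_trans _ _ (\sum_(1 <= tau < (t - k).+1) A * beta ^+ (k + (t - k) - tau))).
  apply: (@le_trans _ _ (\sum_(1 <= tau < t.+1 | (tau < (t - k).+1)%N) A * beta ^+ (k + (t - k) - tau))).
    have nn tau : 0 <= A * beta ^+ (k + (t - k) - tau) by rewrite mulr_ge0 // exprn_ge0 // ltW.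
    have [t0|t0] := posnP t; first by rewrite [leLHS]big_geq; [exact: sumr_ge0 | rewrite t0].
    rewrite [leRHS]big_mkcond [leRHS](big_cat_nat _ (n := t)) //= ler_wpDr //.
      by apply: sumr_ge0 => tau _; case: ifP.
    rewrite big_nat [leRHS]big_nat; apply: ler_sum => tau /andP[tau1 lt].
    case: ltnP => [le|gt]; last first.
      rewrite v0 ?mulmx0; last by rewrite addn1 gt ltnW.
      by rewrite norm1_0.
    rewrite (le_trans (norm1M _ _)) // subnKC //.
    have := Sc (t - tau)%N p tau; rewrite subnK ?(ltnW lt) // subn_gt0 => /(_ lt tau1 Pp) h.
    have := ler_pM (norm1_ge0 _) (norm1_ge0 _) h (linf_norm_ge v (t := t) (s := tau) _).
    rewrite tau1 ltnW // => /(_ isT) /le_trans; apply.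
    rewrite -[X in _ <= _ * _ ^+ X](@prednK (t - tau)%N) ?subn_gt0 // exprS /A.
    rewrite le_eqVlt; apply/orP; left; apply/eqP.
    by field; rewrite gt_eqF.
  rewrite le_eqVlt; apply/orP; left; apply/eqP.
  rewrite [RHS](big_nat_widen _ _ t.+1) //.
  by rewrite ltnS leq_subr.
rewrite -mulr_sumr.
have := ler_wpM2l A0 (geometric_tail k (t - k) b01).
rewrite mulrCA -ler_pdivlMl ?subr_gt0 // => /le_trans; apply.
rewrite /A le_eqVlt; apply/orP; left; apply/eqP; field.
by rewrite !gt_eqF // subr_gt0.
Qed.

Lemma kernel_bound_exp_forgetting beta c : 0 < beta < 1 -> 0 <= c ->
  kernel_bound S (fun N => c * beta ^+ N.-1) -> exp_linf_forgetting P H beta.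
Proof.
move=> b01 c0 Sc; have /andP[b0 b1] := b01.
(* The summand 1 makes the sequence strictly decreasing even when c = 0. *)
pose K := c * m%:R / (beta * (1 - beta)) + 1.
have bb : 0 < beta * (1 - beta) by rewrite mulr_gt0 ?subr_gt0.
have K0 : 0 < K by rewrite ltr_wpDl // divr_ge0 ?(ltW bb) // mulr_ge0.
exists (fun k => K * beta ^+ k); last first.
  exists (K + 1) => [|k]; first by rewrite ltr_wpDl // ltW.
  by rewrite ltr_pM2r ?exprn_gt0 // ltrDl.
split.
- by move=> i j; rewrite ler_pM2l // ler_iXn2l.
- by apply: cvg_geometric; rewrite ger0_norm // ltW.
move=> t p k v1 v2 t1 Pp kt v12.
have key w1 w2 k' : (k' <= t)%N ->
    (forall s, (t - k' + 1 <= s <= t)%N -> w1 s = w2 s) ->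
    l2norm (H (word p w1 t) - H (word p w2 t))
      <= K * beta ^+ k' * linf_norm (fun s => w1 s - w2 s) t.
  move=> k't w12; have [p' Pp' p'E] := sched_extension t1 Pp.
  rewrite !(word_ext _ p'E) !H_irr // -sumrB (le_trans (l2norm_le_norm1 _)) //.
  under eq_bigr do rewrite -mulmxBr.
  have := @kernel_sum_bound beta c p' (fun s => w1 s - w2 s) t k' b01 c0 Sc k't Pp'.
  move=> /(_ _)/le_trans; apply => [s /w12 ->|]; first by rewrite subrr.
  rewrite ler_wpM2r ?linf_norm_ge0 // ler_wpM2r ?exprn_ge0 ?(ltW b0) //.
  by rewrite /K lerDl.
split; last exact: key.
(* The bound with G 0 is the case k = 0 of the other one, against the zero input. *)
have -> : H (word p v1 t) = H (word p v1 t) - H (word p (fun=> 0) t).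
  rewrite [X in _ - X](irr_finite _ H_irr) // big1 ?subr0 // => tau _.
  by rewrite mulmx0.
have := key v1 (fun=> 0) 0%N (leq0n _).
rewrite (_ : (fun s => v1 s - 0) = v1); last by apply/funext => s; rewrite subr0.
by apply=> s; rewrite subn0 addn1 => /andP[lt /(leq_trans lt)]; rewrite ltnn.
Qed.

Lemma forgetting_irr_ued n (sys : lpv_ssa R np m ny n) :
  has_markov_parameters sys S -> reachable sys -> observable sys ->
  linf_forgetting P H -> exists2 beta : R, 0 < beta < 1 & irr_ued P S beta.
Proof.
move=> SE reach obs [G HG]; have Sg := forgetting_kernel_bound HG.
have [Gdec Glim _] := HG.
have Gdecr i j : (i <= j)%N -> G j <= G i by rewrite -Gdec.
pose a : R := ny%:R * m%:R.
have a0 : 0 <= a by rewrite mulr_ge0.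
have [|K K0 TK] := kernel_bound_trans SE reach obs Sg.
  by move=> i j ij; rewrite ler_wpM2l // Gdecr.
have Ka0 : 0 <= K * a by rewrite mulr_ge0.
have [k0 _ Gk] : \forall k \near \oo, `|G k| <= (2 * (K * a + 1))^-1.
  by apply: cvgr0_norm_le Glim _ _; rewrite invr_gt0 mulr_gt0 // ltr_wpDl.
have half L : (forall x, x \in L -> P x) -> size L = k0.+1 ->
    norm1 (transition_seq sys L) <= 2^-1.
  move=> PL sL; apply: (le_trans (TK L PL)).
  have := le_trans (ler_norm _) (Gk k0.+2 (leqW (leqnSn k0))).
  rewrite sL -/a => /(ler_wpM2l Ka0) h; rewrite [leLHS]mulrA (le_trans h) //.
  rewrite invfM mulrCA ger_pMr ?invr_gt0 // ler_pdivrMr ?ltr_wpDl // mul1r.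
  by rewrite lerDl.
have D0 : 0 <= K * (a * G 1%N).
  by apply: le_trans (norm1_ge0 (transition_seq sys [::])) (TK [::] _).
have TD : trans_bound sys (fun=> K * (a * G 1%N)).
  move=> L PL; apply: (le_trans (TK L PL)).
  by rewrite ler_wpM2l // ler_wpM2l // Gdecr.
have [beta b01 Tb] := trans_bound_geometric (ltn0Sn k0) D0 TD half.
have b0 : 0 < beta by case/andP: b01.
have [|c c0 Sc] := trans_bound_kernel SE _ b0 Tb; first by rewrite mulr_ge0.
by exists beta => //; exact: kernel_bound_irr_ued b0 c0 Sc.
Qed.

Lemma gues_irr_ued n (sys : lpv_ssa R np m ny n) : realizes P H sys ->
  gues P sys -> exists2 beta : R, 0 < beta < 1 & irr_ued P S beta.
Proof.
move=> Hsys [beta b01 Hb]; have b0 : 0 < beta by case/andP: b01.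
have [D D0 TD] := gues_rate_trans b0 Hb.
have [c c0 Sc] := trans_bound_kernel (realizes_markov P_unit H_irr Hsys) D0 b0 TD.
by exists beta => //; exact: kernel_bound_irr_ued b0 c0 Sc.
Qed.

Lemma irr_ued_exp_forgetting (beta : R) : 0 < beta < 1 ->
  irr_ued P S beta -> exp_linf_forgetting P H beta.
Proof.
by move=> b01 /irr_ued_kernel_bound [c c0]; exact: kernel_bound_exp_forgetting.
Qed.

Lemma irr_ued_gues_rate n (sys : lpv_ssa R np m ny n) (beta : R) : 0 < beta < 1 ->
  irr_ued P S beta -> has_markov_parameters sys S -> reachable sys -> observable sys ->
  gues_rate P sys beta.
Proof.
move=> /andP[b0 b1] /irr_ued_kernel_bound [c c0 Sc] SE reach obs.
have [|K K0 TK] := kernel_bound_trans SE reach obs Sc.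
  move=> i j ij; rewrite ler_wpM2l // ler_wiXn2l ?(ltW b0) ?(ltW b1) //.
  by rewrite -!subn1 leq_sub2r.
apply: (@trans_gues_rate _ _ _ (K * c)) => //; first by rewrite mulr_ge0.
by move=> L PL; rewrite -mulrA; exact: TK.
Qed.

End Forgetting.
End Decay.

Theorem mainTheorem4 (R : realType) (np m ny : nat) (P : set 'cV[R]_np)
    (P_simplex : P `<=` @simplex R np)
    (P_unit : forall i : 'I_np, P (delta_mx i 0))
    (H : response R np m ny)
    (S : seq 'I_np -> 'M[R]_(ny, m))
    (H_irr : is_irr P H S)
    (H_rank : finite_hankel_rank S) :
  [<-> linf_forgetting P H;
       exists2 beta : R, 0 < beta < 1 & exp_linf_forgetting P H beta;
       exists2 beta : R, 0 < beta < 1 & irr_ued P S beta;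
       exists (n : nat) (sys : lpv_ssa R np m ny n),
         realizes P H sys /\ gues P sys] /\
  (linf_forgetting P H ->
   exists beta : R,
     [/\ 0 < beta < 1,
         exp_linf_forgetting P H beta &
         forall (n : nat) (sys : lpv_ssa R np m ny n),
           minimal_realization P H sys -> gues_rate P sys beta]).
Proof.
have P_unit' : forall i, P (unit_vec R i) by [].
have [r Hr] := H_rank; have [sys0 SE0] := canonical_realization Hr.
have [reach0 obs0] := small_realization_reachable_observable Hr SE0 (leqnn r).
have Hsys0 := markov_realizes H_irr SE0.
have ued := forgetting_irr_ued P_simplex P_unit' H_irr SE0 reach0 obs0.
split; [tfae|].
- move=> /ued [beta b01 Sb]; exists beta => //.
  exact (irr_ued_exp_forgetting H_irr b01 Sb).
- by move=> [beta _ [G HG _]]; apply: ued; exists G.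
- move=> [beta b01 Sb]; exists r, sys0; split => //; exists beta => //.
  exact (irr_ued_gues_rate P_unit' b01 Sb SE0 reach0 obs0).
- move=> [n [sys [Hsys /(gues_irr_ued P_simplex P_unit' H_irr Hsys) [beta b01 Sb]]]].
  by have [G HG _] := irr_ued_exp_forgetting H_irr b01 Sb; exists G.
move=> /ued [beta b01 Sb]; exists beta; split => //.
  exact (irr_ued_exp_forgetting H_irr b01 Sb).
move=> n sys [Hsys sysmin].
have SE := realizes_markov P_unit' H_irr Hsys.
have [reach obs] := small_realization_reachable_observable Hr SE (sysmin _ _ Hsys0).
exact (irr_ued_gues_rate P_unit' b01 Sb SE reach obs).
Qed.
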